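(* Let $G$ be a finite group. Suppose that $G=A_{1}A_{2}=A_{2}A_{3}=A_{1}A_{3}$, where $A_{1}$, $A_{2}$ and $A_{3}$ are soluble subgroups of $G$. If the three indices $|G:N_{G}(A_{1})|$, $|G:N_{G}(A_{2})|$, $|G:N_{G}(A_{3})|$ are pairwise coprime, then $G$ is soluble.
   Context: All groups are finite. *)

(** Since [G = A_i A_j], Dedekind's law gives [N_G(A_i) = A_i (N_G(A_i) :&: A_j)],
    so [N_G(A_i)] is an extension of a soluble group by a soluble group. The
    statement thus reduces to Wielandt's theorem that a group with three soluble
    subgroups [H1], [H2], [H3] of pairwise coprime indices is soluble. For the
    latter, let [P] be a nontrivial normal [p]-subgroup of [H1]. One of [H2], [H3],
    say [H2], has index prime to [p], so it contains a conjugate of [P]; as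
    [G = H2 H1], all conjugates of [P] lie in [H2], whose core in [G] is therefore
    a nontrivial soluble normal subgroup, and one concludes by induction. *)
From mathcomp Require Import all_boot all_fingroup nilpotent.
From mathcomp Require Import pgroup sylow abelian maximal.

Set Implicit Arguments.
Unset Strict Implicit.
Unset Printing Implicit Defensive.

Import GroupScope.

(** Since [G = K * H], every conjugate of [K] has the form [K :^ h] with [h] in [H]. Such [h]
    normalises [P], so [P] lies in all conjugates of [K] once it lies in one. *)
Lemma sub_gcore_conj (gT : finGroupType) (G H K P : {group gT}) (x : gT) :
  K * H = G -> H \subset 'N(P) -> x \in G -> P \subset K :^ x ->
  P \subset gcore K G.
Proof.
move=> defG nPH Gx sPKx.
have conjK y : y \in G -> exists2 h, h \in H & K :^ y = K :^ h.
  rewrite -defG => /mulsgP[k h Kk Hh ->]; exists h => //.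
  by rewrite conjsgM conjGid.
have sPK : P \subset K.
  have [h Hh eqKx] := conjK x Gx.
  by rewrite -(conjSg P K h) (normsP nPH h Hh) -eqKx.
apply/bigcapsP=> y Gy; have [h Hh ->] := conjK y Gy.
by rewrite -(normsP nPH h Hh) conjSg.
Qed.

(** A Sylow [p]-subgroup of [K] is already Sylow in [G], so Sylow's theorem applies to [P]. *)
Lemma pgroup_sub_conj_coprime_index (gT : finGroupType) (p : nat)
    (G K P : {group gT}) :
  prime p -> K \subset G -> coprime p #|G : K| -> P \subset G -> p.-group P ->
  exists2 x, x \in G & P \subset K :^ x.
Proof.
move=> p_pr sKG co_p sPG pP; have [Q sylQ] := Sylow_exists p K.
have sylQG : p.-Sylow(G) Q.
  rewrite pHallE (subset_trans (pHall_sub sylQ) sKG) (card_Hall sylQ).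
  have p'GK : p^'.-nat #|G : K| by rewrite p'natE // -prime_coprime.
  by rewrite -(Lagrange sKG) partnM ?cardG_gt0 ?indexg_gt0 // (part_p'nat p'GK) muln1 eqxx.
have [x Gx sPQx] := Sylow_subJ sylQG sPG pP.
by exists x => //; apply: subset_trans sPQx _; rewrite conjSg (pHall_sub sylQ).
Qed.

Lemma Wielandt_three_solvable (gT : finGroupType) (G H1 H2 H3 : {group gT}) :
    H1 \subset G -> H2 \subset G -> H3 \subset G ->
    solvable H1 -> solvable H2 -> solvable H3 ->
    coprime #|G : H1| #|G : H2| -> coprime #|G : H1| #|G : H3| ->
    coprime #|G : H2| #|G : H3| ->
  solvable G.
Proof.
have [n] := ubnP #|G|; elim: n => // n IHn in gT G H1 H2 H3 *.
rewrite ltnS => leGn sH1G sH2G sH3G solH1 solH2 solH3 co12 co13 co23.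
have [H1_1 | ntH1] := eqVneq (H1 : {set gT}) 1.
  (* Here [#|G : H1|] is [#|G|], a multiple of [#|G : H2|]; coprimality forces [H2 = G]. *)
  have /eqP : #|G : H2| == 1%N.
    rewrite -dvdn1 -(eqP co12) dvdn_gcd dvdnn andbT.
    by rewrite H1_1 indexg1 dvdn_indexg.
  by move/eqP; rewrite indexg_eq1 => /solvableS ->.
have [P [sPH1 /andP[_ nPH1] ntP abelP]] :=
  solvable_norm_abelem solH1 (normal_refl H1) ntH1.
have [p p_pr pP] := is_abelemP abelP; have {}pP := abelem_pgroup pP.
have sPG := subset_trans sPH1 sH1G.
(* [K] will be whichever of [H2], [H3] has index prime to [p]. *)
have finish (K : {group gT}) : K \subset G -> solvable K ->
    coprime #|G : H1| #|G : K| -> coprime p #|G : K| -> solvable G.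
- move=> sKG solK co1K co_p.
  have defG : K * H1 = G by apply: coprime_index_mulG; rewrite // coprime_sym.
  have [x Gx sPKx] := pgroup_sub_conj_coprime_index p_pr sKG co_p sPG pP.
  have sPN := sub_gcore_conj defG nPH1 Gx sPKx.
  pose N := [group of gcore K G].
  have sNK : N \subset K := gcore_sub K G.
  have nNG : N <| G by apply: gcore_normal.
  have ntN : N :!=: 1 by apply: contraNneq ntP => N1; rewrite -subG1 -N1.
  (* Indices in [G / N] divide those in [G], so coprimality survives for the induction. *)
  have co_quo (A B : {group gT}) : A \subset G -> B \subset G ->
      coprime #|G : A| #|G : B| -> coprime #|G / N : A / N| #|G / N : B / N|.
    move=> sAG sBG; have nN := normal_norm nNG.
    have dvd_quo (C : {group gT}) : C \subset G ->
        #|G / N : C / N| %| #|G : C|.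
      by move=> sCG; apply: index_morphim; apply: subset_trans (subsetIl _ _) nN.
    by move/(coprime_dvdl (dvd_quo A sAG))/(coprime_dvdr (dvd_quo B sBG)).
  rewrite (series_sol nNG) (solvableS sNK solK) /=.
  apply: (IHn _ (G / N)%G (H1 / N)%G (H2 / N)%G (H3 / N)%G);
    rewrite ?quotientS ?quotient_sol ?co_quo //.
  exact: leq_trans (ltn_quotient ntN (normal_sub nNG)) leGn.
have [co_p2 | ] := boolP (coprime p #|G : H2|); first exact: (finish H2).
rewrite prime_coprime // negbK => p_dv2.
by apply: (finish H3) => //; apply: coprime_dvdl p_dv2 co23.
Qed.

Lemma solvable_norm_mulg (gT : finGroupType) (G A B : {group gT}) :
  G :=: A * B -> solvable A -> solvable B -> solvable 'N_G(A).
Proof.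
move=> defG solA solB.
have sAG : A \subset G by rewrite defG mulG_subl.
have nAN : A <| 'N_G(A) by rewrite normalSG.
have defN : 'N_G(A) = A * 'N_B(A).
  by rewrite defG -group_modl ?normG.
rewrite (series_sol nAN) solA /= defN quotientMidl.
by rewrite quotient_sol // (solvableS (subsetIl _ _)).
Qed.

Theorem corollary1p8 (gT : finGroupType) (G A1 A2 A3 : {group gT})
    (sA1G : A1 \subset G) (sA2G : A2 \subset G) (sA3G : A3 \subset G)
    (solA1 : solvable A1) (solA2 : solvable A2) (solA3 : solvable A3)
    (defG12 : G :=: (A1 * A2)%g)
    (defG23 : G :=: (A2 * A3)%g)
    (defG13 : G :=: (A1 * A3)%g)
    (co12 : coprime #|G : 'N_G(A1)|%g #|G : 'N_G(A2)|%g)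
    (co13 : coprime #|G : 'N_G(A1)|%g #|G : 'N_G(A3)|%g)
    (co23 : coprime #|G : 'N_G(A2)|%g #|G : 'N_G(A3)|%g) :
  solvable G.
Proof.
(* As [A1 * A3] is a group, its factors commute; the swap makes [A3] a left factor, as its
   normaliser requires. *)
have defG31 : G :=: A3 * A1.
  by rewrite defG13; apply/comm_group_setP; rewrite -defG13 groupP.
apply: Wielandt_three_solvable co12 co13 co23; rewrite ?subsetIl //.
- exact: solvable_norm_mulg defG12 solA1 solA2.
- exact: solvable_norm_mulg defG23 solA2 solA3.
- exact: solvable_norm_mulg defG31 solA3 solA1.
Qed.
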